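(* Let $N\ge 2$ and $T\ge 1$ be integers. For every sequence of loss vectors $\ell_1,\dots,\ell_T\in[0,1]^N$ (which may be chosen adversarially, $\ell_t$ possibly depending on $p_1,\dots,p_t$), the Squint variant (defined in the context) satisfies, simultaneously for all $\epsilon\in[1/N,1)$, $$ \mathrm{Reg}_\epsilon \;\le\; \sqrt{2V_T}\left(1+\sqrt{2\ln\!\left(\frac{\frac12+\ln(T+1)}{\epsilon}\right)}\right)+5\ln\!\left(1+\frac{1+2\ln(T+1)}{\epsilon}\right). $$
   Context: Expert problem: in each round $t=1,\dots,T$ the learner chooses a distribution $p_t\in\Delta_N$ (the probability simplex in $\mathbb{R}^N$) over $N$ experts, the adversary chooses a loss vector $\ell_t\in[0,1]^N$, and the learner suffers loss $\langle p_t,\ell_t\rangle$ and observes $\ell_t$. For $\epsilon\in[1/N,1)$, the $\epsilon$-quantile regret is $$\mathrm{Reg}_\epsilon=\sum_{t=1}^T\langle p_t,\ell_t\rangle-\sum_{t=1}^T\ell_{t,i_\epsilon},$$ where $i_\epsilon$ is the $\lfloor\epsilon N\rfloor$-th best expert, i.e. when experts are sorted by increasing cumulative loss $\sum_{t=1}^T\ell_{t,i}$ (ties broken arbitrarily), $i_\epsilon$ is in position $\lfloor\epsilon N\rfloor$. Regret vectors: $r_t=\langle p_t,\ell_t\rangle\mathbf 1-\ell_t\in\mathbb{R}^N$ ($\mathbf 1$ the all-one vector), $R_t=\sum_{s=1}^t r_s$, $R_0=0$. Squint potential: for $R\in\mathbb{R}$, $V\ge 0$, $$\Phi(R,V)=\int_0^{1/2}\frac{e^{\eta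 R-\eta^2V}-1}{\eta}\,d\eta .$$ Thus $\frac{\partial\Phi}{\partial R}(R,V)=\int_0^{1/2}e^{\eta R-\eta^2V}\,d\eta>0$ and $-\frac{\partial\Phi}{\partial V}(R,V)=\frac{\partial^2\Phi}{\partial R^2}(R,V)=\int_0^{1/2}\eta e^{\eta R-\eta^2V}\,d\eta>0$. Squint variant: $V_0=0$. At time $t$ the learner plays $p_t\in\Delta_N$ with $$p_{t,i}\propto\frac{\partial\Phi}{\partial R}(R_{t-1,i},V_{t-1})$$ (normalized over $i=1,\dots,N$ to sum to 1). After observing $\ell_t$, set $V_t=V_{t-1}+v_t$ (so $V_t=\sum_{s=1}^t v_s$), where $v_t$ is a real number satisfying the implicit equation $$v_t=\sum_{i=1}^N q_{t,i}\,r_{t,i}^2,\qquad q_t\in\Delta_N,\quad q_{t,i}\propto-\frac{\partial\Phi}{\partial V}(R_{t,i},V_t)=\int_0^{1/2}\eta e^{\eta R_{t,i}-\eta^2V_t}\,d\eta,\quad V_t=V_{t-1}+v_t;$$ equivalently $v_t\in[0,1]$ is a root of $f(v)=\sum_{i=1}^N\frac{\partial^2\Phi}{\partial R^2}(R_{t,i},V_{t-1}+v)\,(v-r_{t,i}^2)$. (Such a root exists in $[0,1]$ by continuity, since $f(0)\le 0\le f(1)$; if there are several, any may be used.) *)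

(* Defs.v *)
From HB Require Import structures.
From mathcomp Require Import all_boot all_order all_algebra.
From mathcomp Require Import perm.
From mathcomp Require Import all_classical all_reals all_analysis.

Set Implicit Arguments.
Unset Strict Implicit.
Unset Printing Implicit Defensive.

Import Order.TTheory GRing.Theory Num.Theory.
Local Open Scope ring_scope.

Section Experts.
Variables (R : realType) (N : nat).
Implicit Types (p l : nat -> 'I_N -> R) (v : nat -> R).

(* Sequences indexed by rounds are functions on nat; only the values at
   1, ..., T are ever used. *)

Definition learner_loss (p l : 'I_N -> R) : R := \sum_i p i * l i.

Definition inst_regret p l (t : nat) (i : 'I_N) : R :=
  learner_loss (p t) (l t) - l t i.

Definition cum_regret p l (t : nat) (i : 'I_N) : R :=
  \sum_(1 <= s < t.+1) inst_regret p l s i.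

Definition cum_loss l (t : nat) (i : 'I_N) : R := \sum_(1 <= s < t.+1) l s i.

Definition cum_variance v (t : nat) : R := \sum_(1 <= s < t.+1) v s.

(* [i] is in (1-based) position floor (eps * N) of some ordering [s] of the
   experts by nondecreasing loss [L]; ranging over all such [s] amounts to
   breaking ties arbitrarily. *)
Definition quantile_expert (L : 'I_N -> R) (eps : R) (i : 'I_N) : Prop :=
  exists s : {perm 'I_N},
    (forall j k : 'I_N, (j <= k)%N -> L (s j) <= L (s k)) /\
    exists j : 'I_N, (j.+1)%:Z = Num.floor (eps * N%:R) /\ i = s j.

(* The eps-quantile regret when [i] is the quantile expert. *)
Definition regret_against p l (T : nat) (i : 'I_N) : R :=
  \sum_(1 <= t < T.+1) learner_loss (p t) (l t) - cum_loss l T i.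

(* The integrand at eta = 0 is 0 by the convention x / 0 = 0; a single point
   does not affect the integral. *)
Definition squint_potential (x V : R) : R :=
  \int[lebesgue_measure]_(eta in `[0, 2^-1]%classic)
    ((expR (eta * x - eta ^+ 2 * V) - 1) / eta).

Definition squint_dR (x V : R) : R :=
  derive1 (fun y => squint_potential y V) x.

(* The formula for the potential is used for every real V, so this is a
   two-sided derivative also at V = 0. *)
Definition squint_dV (x V : R) : R :=
  derive1 (fun W => squint_potential x W) V.

(* The probability vector proportional to [w]. *)
Definition normalize (w : 'I_N -> R) (i : 'I_N) : R := w i / \sum_j w j.

(* [p], [l], [v] are the plays, losses and variance increments of one execution
   of the algorithm over T rounds.  The equation for [v t] is implicit, since
   [cum_variance v t] contains [v t]; any solution is allowed. *)
Record squint_run (T : nat) p l v : Prop := {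
  squint_play : forall t, (1 <= t <= T)%N -> forall i,
    p t i =
    normalize (fun j => squint_dR (cum_regret p l t.-1 j)
                                  (cum_variance v t.-1)) i;
  squint_update : forall t, (1 <= t <= T)%N ->
    v t = \sum_i
      normalize (fun j => - squint_dV (cum_regret p l t j)
                                      (cum_variance v t)) i
      * inst_regret p l t i ^+ 2
}.

End Experts.

(* Main.v *)
(* Write Phi for the potential and S_t for the sum over i of Phi (R_(t,i), V_t).

   Upper bound: with a = eta r, b = eta^2 v the integrand of the increment of
   Phi is controlled by e^(a-b) (1 - a^2 + b) <= e^(a - a^2) <= 1 + a, valid for
   a >= -1/2.  Summed over the experts, the linear term vanishes by the choice
   of p_t and the quadratic term by the implicit equation for v_t, so
   S_T <= S_0 = 0.

   Lower bound: every expert has R_i >= -T and V_T <= T, so its potential is at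
   least -B with B = 1/2 + ln (T + 1).  If Reg_eps exceeded the claimed bound,
   each of the k = floor (eps N) best experts would have potential at least
   2 B / eps - B.  Since k >= 1 gives N < (k + 1) / eps <= 2 k / eps, this would
   make S_T positive.  The factor 2, needed because N / k may be close to
   2 / eps, is absorbed by the slack in the estimate of Phi around the maximiser
   of eta |-> eta R - eta^2 V. *)

Require Import Defs.
From HB Require Import structures.
From mathcomp Require Import all_boot all_order all_algebra.
From mathcomp Require Import all_classical all_reals all_analysis.
From mathcomp Require Import perm measurable_realfun ring lra.

Import Order.TTheory GRing.Theory Num.Theory numFieldNormedType.Exports.
Local Open Scope ring_scope.

Section Squint.
Variable R : realType.
Implicit Types (x y V eta : R).
Local Notation mu := (@lebesgue_measure R).
Local Notation D := `]0 : R, 2^-1]%classic.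

(** * Elementary bounds for the exponential and the logarithm *)

Lemma expR_ge_series x n : 0 <= x -> \sum_(i < n) x ^+ i / i`!%:R <= expR x.
Proof.
move=> x0; rewrite /expR.
have := @is_cvg_series_exp_coeff R x => cv.
have nd : nondecreasing_seq (series (exp_coeff x)).
  apply/nondecreasing_seqP => k; rewrite /series/= big_nat_recr//= lerDl.
  by rewrite /exp_coeff/= divr_ge0// exprn_ge0.
have := nondecreasing_cvgn_le nd cv n.
by rewrite /series/= big_mkord.
Qed.

Lemma expR_ge_cubic x : 0 <= x ->
  1 + x + x ^+ 2 / 2 + x ^+ 3 / 6 <= expR x.
Proof.
move=> /(expR_ge_series x 4); rewrite !big_ord_recr big_ord0 /= => h.
apply: le_trans h; rewrite !expr0 !expr1 /factorial /=; lra.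
Qed.

(** After inversion the claim is 1 / (1 + x) <= e^(x^2 - x). For x >= 0 the tangent bound suffices,
    as (1 + x) (1 + x^2 - x) = 1 + x^3; for x < 0 the cubic expansion is used. *)
Lemma expR_sub_sqr_le x : - 2^-1 <= x -> expR (x - x ^+ 2) <= 1 + x.
Proof.
move=> hx; have x1 : 0 < 1 + x by lra.
rewrite -[_ - _]opprK expRN opprB invf_ple ?posrE ?expR_gt0//.
have [x0|x0] := leP 0 x.
- apply: le_trans (expR_ge1Dx _); rewrite -div1r ler_pdivrMr//.
  have := exprn_ge0 3 x0; nra.
- have y0 : 0 <= x ^+ 2 - x by have := sqr_ge0 x; lra.
  apply: le_trans (expR_ge_cubic _ y0); rewrite -div1r ler_pdivrMr//.
  have := exprn_ge0 3 y0; set z := _ ^+ 3 => z0.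
  (* The quadratic Taylor polynomial at x^2 - x, times 1 + x, equals 1 plus half of this product. *)
  have : 0 <= x ^+ 2 * (1 + x - x ^+ 2 + x ^+ 3).
    by apply: mulr_ge0; [exact: sqr_ge0|nra].
  nra.
Qed.

Lemma expR_step_le (a b : R) : - 2^-1 <= a ->
  expR (a - b) * (1 - a ^+ 2 + b) <= 1 + a.
Proof.
move=> ha; apply: le_trans (expR_sub_sqr_le _ ha).
have -> : a - a ^+ 2 = (a - b) + (b - a ^+ 2) by ring.
rewrite [leRHS]expRD ler_pM2l ?expR_gt0//.
by apply: le_trans (expR_ge1Dx _); lra.
Qed.

(** The difference [h] of the two sides vanishes at 0 and has derivative 1 - (1 - y) e^y >= 0. *)
Lemma expR_pade_le x : 0 <= x <= 2 -> (2 - x) * expR x <= 2 + x.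
Proof.
move=> /andP[x0 x2].
pose h y : R := 2 + y - (2 - y) * expR y.
have dh y : is_derive y (1 : R) h (1 - (1 - y) * expR y).
  by rewrite /h; apply: is_derive_eq; rewrite /GRing.scale /=; ring.
have := @ger0_derive1_le_cc R h 0 2 _ _ _ 0 x.
have -> : h 0 = 0 by rewrite /h expR0; ring.
rewrite /h subr_ge0; apply => //.
- move=> y _; rewrite derive1E (@derive_val _ _ _ _ _ _ _ (dh y)) subr_ge0.
  by rewrite -ler_pdivlMr ?expR_gt0// div1r -expRN expR_ge1Dx.
- apply: derivable_within_continuous => y _; by have [] := dh y.
- by rewrite in_itv/= lexx ler0n.
- by rewrite in_itv/= x0.
Qed.

(** This is [expR_pade_le] at z = 2 x / (2 + x), the point where (2 + z) / (2 - z) = 1 + x. *)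
Lemma ln1D_ge x : 0 < x -> 2 * x / (2 + x) <= ln (1 + x).
Proof.
move=> x0; rewrite -ler_expR lnK ?posrE; last lra.
have := @expR_pade_le (2 * x / (2 + x)).
have -> : 2 - 2 * x / (2 + x) = 4 / (2 + x) by field; lra.
have -> : 2 + 2 * x / (2 + x) = 4 / (2 + x) * (1 + x) by field; lra.
rewrite ler_pM2l; last by apply: divr_gt0; lra.
apply; rewrite divr_ge0 ?ler_pdivrMr; lra.
Qed.

Lemma ln2_ge : 2 / 3 <= ln 2 :> R.
Proof.
have := ln1D_ge _ ltr01.
have -> : 1 + 1 = 2 :> R by ring.
have -> : 2 + 1 = 3 :> R by ring.
by rewrite mulr1.
Qed.

(** Gives rational certificates for numerical bounds on ln y, from ln 2 >= 2/3 and [ln1D_ge]. *)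
Lemma ln_dyadic_ge (k : nat) (r x y : R) : 0 < x -> r * (2 + x) <= 2 * x ->
  2 ^+ k * (1 + x) <= y -> 2 / 3 * k%:R + r <= ln y.
Proof.
move=> x0 hr hy; have p0 : 0 < 2 ^+ k * (1 + x).
  by rewrite mulr_gt0 ?exprn_gt0; lra.
apply: (@le_trans _ _ (ln (2 ^+ k * (1 + x)))); last first.
  by rewrite ler_ln ?posrE// (lt_le_trans p0).
rewrite lnM ?posrE ?exprn_gt0//; last lra.
rewrite lnXn// -[ln 2 *+ k]mulr_natr lerD//.
  by apply: ler_wpM2r; [exact: ler0n|exact: ln2_ge].
by apply: le_trans (ln1D_ge _ x0); rewrite ler_pdivlMr//; lra.
Qed.

(* If V is at least the regret bound, a lower bound on X gives one on V <= T,
   which X >= 1/2 + ln (T + 1) turns into a better one on X; two rounds give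
   these constants. *)
Lemma large_variance_bootstrap (T : nat) (X V s : R) :
    V <= T%:R -> 2^-1 + ln T.+1%:R <= X -> 7 / 6 <= X ->
    0 <= V -> 0 <= s -> s ^+ 2 = 2 * ln X ->
    Num.sqrt (2 * V) * (1 + s) + 5 * ln (1 + 2 * X) <= V ->
  36 / 10 <= X /\ 157 / 100 <= s.
Proof.
move=> VT XT X1 V0 s0 s2; set q := Num.sqrt _.
have q2 : q ^+ 2 = 2 * V by rewrite sqr_sqrtr//; lra.
have q0 : 0 <= q by exact: sqrtr_ge0.
set L := ln (1 + 2 * X) => hV.
have T1 (c : R) : c <= V -> c + 1 <= T.+1%:R.
  by move=> cV; rewrite -natr1; lra.
have l1 : 1 / 8 <= ln X.
  by apply: le_trans (ln_dyadic_ge 0 (1 / 8) 6^-1 X _ _ _);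
    rewrite ?exprS ?expr0 /=; lra.
have L1 : 1 <= L.
  by apply: le_trans (ln_dyadic_ge 1 (1 / 2) (2 / 3) (1 + 2 * X) _ _ _);
    rewrite ?exprS ?expr0 /=; lra.
have s1 : 1 / 2 <= s by nra.
(* As V = q^2 / 2, the hypothesis is quadratic in q; with s >= 1/2 and L >= 1 it forces q >= 5. *)
have V1 : 12 <= V by nra.
have t1 : 24 / 10 <= ln T.+1%:R :> R.
  have := T1 _ V1 => hT.
  by apply: le_trans (ln_dyadic_ge 3 (4 / 10) (5 / 8) _ _ _ _);
    rewrite ?exprS ?expr0 /=; lra.
(* Second round, from X >= 1/2 + 24/10 = 2 (1 + 9/20). *)
have l2 : 1 <= ln X.
  by apply: le_trans (ln_dyadic_ge 1 (1 / 3) (9 / 20) X _ _ _);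
    rewrite ?exprS ?expr0 /=; lra.
have L2 : 18 / 10 <= L.
  by apply: le_trans (ln_dyadic_ge 2 (1 / 2) (17 / 25) (1 + 2 * X) _ _ _);
    rewrite ?exprS ?expr0 /=; lra.
have s2' : 14 / 10 <= s by nra.
have V2 : 26 <= V by nra.
have t2 : 316 / 100 <= ln T.+1%:R :> R.
  have := T1 _ V2 => hT.
  by apply: le_trans (ln_dyadic_ge 4 (1 / 2) (11 / 16) _ _ _ _);
    rewrite ?exprS ?expr0 /=; lra.
have X3 : 36 / 10 <= X by lra.
have l3 : 1235 / 1000 <= ln X.
  by apply: le_trans (ln_dyadic_ge 1 (57 / 100) (8 / 10) X _ _ _);
    rewrite ?exprS ?expr0 /=; lra.
by split=> //; nra.
Qed.

(** * Integrability and the integrand of the potential *)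

Lemma integrable_half (f : R -> R) (M : R) :
    (forall eta, 0 < eta -> {for eta, continuous f}) ->
    (forall eta, 0 < eta <= 2^-1 -> `|f eta| <= M) ->
  mu.-integrable D (EFin \o f).
Proof.
move=> cf bf; apply: measurable_bounded_integrable => //.
- by rewrite /= lebesgue_measure_itv/= lte_fin; case: ifP => //=;
    rewrite -EFinB ltry.
- have mf : measurable_fun `]0 : R, +oo[%classic f.
    apply: open_continuous_measurable_fun; first exact: interval_open.
    by move=> y; rewrite inE/= in_itv/= andbT => /cf.
  apply: measurable_funS mf => //.
  by move=> y /=; rewrite !in_itv/= => /andP[-> _].
- exists M; split; first exact: num_real.
  move=> z Mz y /=; rewrite in_itv/= => /bf/le_trans; apply; exact: ltW.
Qed.

Definition rate x V eta : R := eta * x - eta ^+ 2 * V.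

Lemma continuous_rate x V : continuous (rate x V).
Proof.
move=> y; apply: differentiable_continuous; apply/derivable1_diffP.
by rewrite /rate; apply: ex_derive.
Qed.

Lemma continuous_expR_rate x V : continuous (fun eta => expR (rate x V eta)).
Proof.
move=> y; apply: (@continuous_comp _ _ _ (rate x V)).
  exact: continuous_rate.
exact: continuous_expR.
Qed.

Definition quot x V eta : R := (expR (rate x V eta) - 1) / eta.

Lemma continuous_quot x V eta : 0 < eta -> {for eta, continuous (quot x V)}.
Proof.
move=> e0; apply: cvgM; last by apply: cvgV => //; rewrite gt_eqF.
by apply: cvgB; [exact: continuous_expR_rate | exact: cvg_cst].
Qed.

(** Linear in |z|, so that together with [rate_norm] it absorbs the division by eta in [quot]. *)
Lemma expR_sub1_norm (z : R) : `|expR z - 1| <= `|z| * expR `|z|.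
Proof.
have [z0|z0] := leP 0 z.
- have := expR_ge1Dx (- z); rewrite expRN => h.
  have e0 := expR_gt0 z; have e1 : 1 <= expR z by rewrite -expR0 ler_expR.
  rewrite (ger0_norm z0) ger0_norm ?subr_ge0// lerBlDr.
  have : (1 - z) * expR z <= 1 by rewrite -ler_pdivlMr// div1r.
  lra.
- have e1 : expR z <= 1 by rewrite expR_le1 ltW.
  rewrite (ltr0_norm z0) ler0_norm ?subr_le0//.
  have := expR_ge1Dx z.
  have : 1 <= expR (- z) by rewrite -expR0 ler_expR oppr_ge0 ltW.
  move=> h1 h2; have : 0 <= (- z) * (expR (- z) - 1) by apply: mulr_ge0; lra.
  lra.
Qed.

Lemma rate_norm x V eta : 0 < eta <= 2^-1 ->
  `|rate x V eta| <= eta * (`|x| + `|V|).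
Proof.
move=> /andP[e0 e1]; rewrite /rate (le_trans (ler_normB _ _))//.
rewrite !normrM (gtr0_norm e0) mulrDr lerD2l -mulrA ler_pM2l//.
by rewrite ler_piMl//; lra.
Qed.

Lemma rate_norm_le x V eta : 0 < eta <= 2^-1 -> `|rate x V eta| <= `|x| + `|V|.
Proof.
move=> he; rewrite (le_trans (rate_norm _ _ _ he))// ler_piMl ?addr_ge0//.
by case/andP: he => _ ?; lra.
Qed.

Lemma expR_rate_norm x V eta : 0 < eta <= 2^-1 ->
  `|expR (rate x V eta)| <= expR (`|x| + `|V|).
Proof.
by move=> /(rate_norm_le x V)/(le_trans (ler_norm _)) h;
  rewrite ger0_norm ?expR_ge0// ler_expR.
Qed.

Lemma integrable_quot x V : mu.-integrable D (EFin \o quot x V).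
Proof.
apply: (integrable_half _ ((`|x| + `|V|) * expR (`|x| + `|V|))).
  by move=> eta; exact: continuous_quot.
move=> eta he; have e0 : 0 < eta by case/andP: he.
rewrite /quot normrM normfV (gtr0_norm e0) ler_pdivrMr//.
apply: le_trans (expR_sub1_norm _) _.
rewrite mulrAC ler_pM ?expR_ge0//; first by rewrite mulrC rate_norm.
by rewrite ler_expR rate_norm_le.
Qed.

Lemma integrable_expR_rate x V :
  mu.-integrable D (EFin \o (fun eta => expR (rate x V eta))).
Proof.
apply: (integrable_half _ (expR (`|x| + `|V|))).
  by move=> eta _; exact: continuous_expR_rate.
by move=> eta; exact: expR_rate_norm.
Qed.

Lemma integrable_mul_expR_rate x V :
  mu.-integrable D (EFin \o (fun eta => eta * expR (rate x V eta))).
Proof.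
apply: (integrable_half _ (expR (`|x| + `|V|))).
  move=> eta _; apply: cvgM; [exact: cvg_id|exact: continuous_expR_rate].
move=> eta he; rewrite normrM -[leRHS]mul1r ler_pM// ?expR_rate_norm//.
by case/andP: he => ? ?; rewrite gtr0_norm//; lra.
Qed.

(* Half-open integration domain: [quot] has the junk value 0 at eta = 0. *)
Lemma potentialE x V : squint_potential x V = \int[mu]_(eta in D) quot x V eta.
Proof.
rewrite Rintegral_itv_obnd_cbnd; last exact: integrable_quot.
by [].
Qed.

(** * Partial derivatives of the potential *)

(** Differentiation under the integral sign: the factor eta from the chain rule cancels the
    denominator, and for y within 1 of x a constant dominates the derivative. *)
Lemma squint_dRE x V : squint_dR x V = \int[mu]_(eta in D) expR (rate x V eta).
Proof.
rewrite /squint_dR.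
under [fun y => _]eq_fun do rewrite potentialE.
have dq (y eta : R) : D eta ->
    is_derive y 1 (fun z : R => quot z V eta) (expR (rate y V eta)).
  rewrite /= in_itv/= => /andP[e0 _].
  rewrite /quot /rate; apply: is_derive_eq.
  by rewrite !scaler0 !subr0 !add0r /GRing.scale /=; field; rewrite gt_eqF.
have d1 y eta : D eta ->
    partial1of2 (fun x => quot x V) y eta = expR (rate y V eta).
  by move=> De; rewrite partial1of2E; apply: derive_val; exact: dq.
rewrite (@differentiation_under_integral _ _ _ mu _ _ _ x (x - 1) (x + 1) _ _ _
   (fun=> expR (`|x| + 1 + `|V|))) //=.
- by apply: eq_Rintegral => eta /[!inE]; exact: d1.
- by rewrite in_itv/=; apply/andP; split; lra.
- by move=> y _; exact: integrable_quot.
- by apply: (integrable_half _ (expR (`|x| + 1 + `|V|))) => [eta _|eta _];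
    [exact: cvg_cst|rewrite ger0_norm// expR_ge0].
- move=> y eta; rewrite !in_itv/= => yx De; rewrite d1//.
  rewrite (le_trans (expR_rate_norm _ _ _ De))// ler_expR lerD2r.
  have -> : y = x + (y - x) by rewrite addrC subrK.
  rewrite (le_trans (ler_normD _ _))// lerD2l ler_norml; lra.
Qed.

Lemma squint_dVE x V :
  - squint_dV x V = \int[mu]_(eta in D) (eta * expR (rate x V eta)).
Proof.
rewrite /squint_dV.
under [fun y => _]eq_fun do rewrite potentialE.
have dq (y eta : R) : D eta ->
    is_derive y 1 (fun z : R => quot x z eta)
      (-1 * (eta * expR (rate x y eta))).
  rewrite /= in_itv/= => /andP[e0 _].
  rewrite /quot /rate; apply: is_derive_eq.
  by rewrite !scaler0 !subr0 !add0r /GRing.scale /=; field; rewrite gt_eqF.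
have d1 y eta : D eta ->
    partial1of2 (fun z => quot x z) y eta = -1 * (eta * expR (rate x y eta)).
  by move=> De; rewrite partial1of2E; apply: derive_val; exact: dq.
rewrite (@differentiation_under_integral _ _ _ mu _ _ _ V (V - 1) (V + 1) _ _ _
   (fun=> expR (`|x| + (`|V| + 1)))) //=.
- apply: (canLR opprK); rewrite -mulN1r -RintegralZl//; last first.
    exact: integrable_mul_expR_rate.
  by apply: eq_Rintegral => eta /[!inE]; exact: d1.
- by rewrite in_itv/=; apply/andP; split; lra.
- by move=> y _; exact: integrable_quot.
- by apply: (integrable_half _ (expR (`|x| + (`|V| + 1)))) => [eta _|eta _];
    [exact: cvg_cst|rewrite ger0_norm// expR_ge0].
- move=> y eta; rewrite !in_itv/= => yx De; rewrite d1//.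
  rewrite mulN1r normrN normrM -[leRHS]mul1r ler_pM//.
    by case/andP: De => ? ?; rewrite gtr0_norm//; lra.
  rewrite (le_trans (expR_rate_norm _ _ _ De))// ler_expR lerD2l.
  have -> : y = V + (y - V) by rewrite addrC subrK.
  rewrite (le_trans (ler_normD _ _))// lerD2l ler_norml; lra.
Qed.

(** * Integrals over subintervals *)

Lemma Rintegral_half_ge (f g : R -> R) (a b : R) :
  0 < a -> a <= b -> b <= 2^-1 ->
  mu.-integrable D (EFin \o f) ->
  (forall eta, 0 < eta <= 2^-1 -> 0 <= f eta) ->
  mu.-integrable `[a, b] (EFin \o g) ->
  (forall eta, a <= eta <= b -> g eta <= f eta) ->
  \int[mu]_(eta in `[a, b]) g eta <= \int[mu]_(eta in D) f eta.
Proof.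
move=> a0 ab b2 intf f0 intg gf.
have sub : (`[a, b] `<=` D)%classic.
  move=> y /=; rewrite !in_itv/= => /andP[ay yb].
  by rewrite (lt_le_trans a0 ay) (le_trans yb).
have intf' : mu.-integrable `[a, b] (EFin \o f) by apply: integrableS intf.
apply: (@le_trans _ _ (\int[mu]_(eta in `[a, b]) f eta)).
  by apply: le_Rintegral.
rewrite /Rintegral fine_le//; [exact: integrable_fin_num..|].
apply: ge0_subset_integral => //; first by case/integrableP: intf.
Qed.

Lemma integrable_Zinv (k a b : R) : 0 < a ->
  mu.-integrable `[a, b] (EFin \o (fun eta => k * eta^-1)).
Proof.
move=> a0; apply: continuous_compact_integrable; first exact: segment_compact.
apply: continuous_in_subspaceT => y; rewrite inE/= in_itv/= => /andP[ay _].
apply: cvgM; first exact: cvg_cst.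
by apply: cvgV => //; rewrite gt_eqF// (lt_le_trans a0).
Qed.

Lemma Rintegral_Zinv (k a b : R) : 0 < a -> a <= b ->
  \int[mu]_(eta in `[a, b]) (k * eta^-1) = k * ln (b / a).
Proof.
move=> a0; rewrite le_eqVlt => /predU1P[<-|ab].
  by rewrite set_itv1 Rintegral_set1 divff ?gt_eqF// ln1 mulr0.
have b0 := lt_trans a0 ab.
have dln (y : R) : a < y ->
    is_derive y (1 : R) (fun z : R => k * ln z) (k * y^-1).
  move=> ay; have ? := is_derive1_ln (lt_trans a0 ay).
  by apply: is_derive_eq; rewrite /GRing.scale /=; ring.
have cln (y : R) : 0 < y -> {for y, continuous (fun z : R => k * ln z)}.
  by move=> y0; apply: cvgM; [exact: cvg_cst|exact: continuous_ln].
rewrite ln_div ?posrE// mulrBr /Rintegral.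
rewrite (continuous_FTC2 (F := fun y => k * ln y)) //.
- apply: continuous_in_subspaceT => y; rewrite inE/= in_itv/= => /andP[ay _].
  apply: cvgM; first exact: cvg_cst.
  by apply: cvgV => //; rewrite gt_eqF// (lt_le_trans a0).
- split.
  + by move=> y; rewrite in_itv/= => /andP[/dln[]].
  + by apply: cvg_at_right_filter; exact: cln.
  + by apply: cvg_at_left_filter; exact: cln.
- move=> y; rewrite in_itv/= => /andP[ay _]; rewrite derive1E.
  by apply: derive_val; exact: dln.
Qed.

Lemma integrable_itv_cst (a b : bool) (x y c : R) :
  mu.-integrable [set` Interval (BSide a x) (BSide b y)] (EFin \o (fun=> c)).
Proof.
apply: measurable_bounded_integrable => //.
- by rewrite /= lebesgue_measure_itv/= lte_fin; case: ifP => //=;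
    rewrite -EFinB ltry.
- by exists `|c|; split; [exact: num_real|move=> z Mz t _ /=; exact: ltW].
Qed.

Lemma Rintegral_itv_cst (a b : bool) (x y c : R) : x <= y ->
  \int[mu]_(eta in [set` Interval (BSide a x) (BSide b y)]) c = c * (y - x).
Proof.
move=> xy; rewrite Rintegral_cst//= lebesgue_measure_itv/= lte_fin.
move: xy; rewrite le_eqVlt => /predU1P[->|->]; last by [].
by rewrite ltxx subrr.
Qed.

(** * Lower bounds on the potential *)

Lemma quot_le x y V W eta : 0 < eta -> x <= y -> W <= V ->
  quot x V eta <= quot y W eta.
Proof.
move=> e0 xy WV.
rewrite /quot ler_pM2r ?invr_gt0// lerD2r ler_expR /rate lerB//.
  by rewrite ler_pM2l.
by rewrite ler_pM2l// exprn_gt0.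
Qed.

Lemma potential_le x y V W : x <= y -> W <= V ->
  squint_potential x V <= squint_potential y W.
Proof.
move=> xy WV; rewrite !potentialE; apply: le_Rintegral => //;
  [exact: integrable_quot..|].
by move=> eta; rewrite /= in_itv/= => /andP[e0 _]; exact: quot_le.
Qed.

(** Split at c = 1 / (T + 1). Above c the integrand is at least -1 / eta, which costs ln ((T + 1) /
    2) <= ln (T + 1) - 1/2. Below c, e^z >= 1 + z bounds it by - T (1 + c), which costs T (1 + c) c
    = 1 - c^2 <= 1. *)
Lemma potential_ge (T : nat) : (0 < T)%N ->
  - (2^-1 + ln T.+1%:R) <= squint_potential (- T%:R) T%:R :> R.
Proof.
move=> T0; rewrite potentialE; set f := quot _ _.
pose c : R := T.+1%:R^-1.
have T1 : 1 <= T%:R :> R by rewrite ler1n.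
have TS : T.+1%:R = T%:R + 1 :> R by rewrite natr1.
have c0 : 0 < c by rewrite invr_gt0 ltr0n.
have c2 : c <= 2^-1 by rewrite lef_pV2 ?posrE ?ltr0n//; lra.
have fint : mu.-integrable D (EFin \o f) by exact: integrable_quot.
have := @Rintegral_itvB R f (BRight 0) (BRight 2^-1) c fint.
rewrite !bnd_simp => /(_ (ltW c0) c2) /eqP; rewrite subr_eq => /eqP ->.
have -> : - (2^-1 + ln T.+1%:R) = - (ln T.+1%:R - 2^-1) - 1 :> R by lra.
apply: lerD.
- apply: (@le_trans _ _ (- ln (2^-1 / c))).
    rewrite lerN2 /c invrK lnM ?posrE ?invr_gt0 ?ltr0n// lnV ?posrE//.
    have : 2 / 3 <= ln 2 :> R by exact: ln2_ge.
    by lra.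
  have inti : mu.-integrable `[c, 2^-1] (EFin \o (fun eta => -1 * eta^-1)).
    exact: integrable_Zinv.
  have inti' : mu.-integrable `]c, 2^-1] (EFin \o (fun eta => -1 * eta^-1)).
    by apply: integrableS inti => //; apply: subset_itvr; rewrite bnd_simp.
  rewrite -mulN1r -Rintegral_Zinv//.
  rewrite -Rintegral_itv_obnd_cbnd//; apply: le_Rintegral => //.
    by apply: integrableS fint => //; apply: subset_itvr; rewrite bnd_simp ltW.
  move=> eta; rewrite /= in_itv/= => /andP[ce _].
  rewrite /f /quot ler_pM2r ?invr_gt0 ?(lt_trans c0)//.
  by have := expR_gt0 (rate (- T%:R) T%:R eta); lra.
- apply: (@le_trans _ _ (- (T%:R * (1 + c)) * (c - 0))).
    rewrite subr0 mulNr lerN2.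
    have Tc : (T%:R + 1) * c = 1 by rewrite /c TS mulfV//; lra.
    nra.
  rewrite -(Rintegral_itv_cst false false)//; last exact: ltW.
  apply: le_Rintegral => //; first exact: integrable_itv_cst.
    by apply: integrableS fint => //; apply: subset_itvl; rewrite bnd_simp.
  move=> eta; rewrite /= in_itv/= => /andP[e0 ec].
  rewrite /f /quot ler_pdivlMr//.
  have := expR_ge1Dx (rate (- T%:R) T%:R eta).
  rewrite {1}/rate; suff : eta * T%:R * eta <= eta * T%:R * c by lra.
  by rewrite ler_pM2l// mulr_gt0//; lra.
Qed.

(** Compare with the worst case (-T, T). The difference of integrands is nonnegative by
    monotonicity, and on [a, b] it is at least g because the worst-case integrand is nonpositive. *)
Lemma potential_ge_gain (T : nat) x V (g : R -> R) (a b : R) : (0 < T)%N ->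
    - T%:R <= x -> V <= T%:R -> 0 < a -> a <= b -> b <= 2^-1 ->
    mu.-integrable `[a, b] (EFin \o g) ->
    (forall eta, a <= eta <= b -> g eta * eta <= expR (rate x V eta) - 1) ->
  \int[mu]_(eta in `[a, b]) g eta - (2^-1 + ln T.+1%:R) <= squint_potential x V.
Proof.
move=> T0 Tx VT a0 ab b2 intg gq.
suff : \int[mu]_(eta in `[a, b]) g eta <=
    squint_potential x V - squint_potential (- T%:R) T%:R.
  have : - (2^-1 + ln T.+1%:R) <= squint_potential (- T%:R) T%:R :> R.
    exact: potential_ge.
  by lra.
rewrite !potentialE -RintegralB//; [|exact: integrable_quot..].
apply: Rintegral_half_ge => //.
- by apply: (integrableB _ (integrable_quot x V)
                         (integrable_quot (- T%:R) T%:R)).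
- by move=> eta /andP[e0 _]; rewrite subr_ge0 quot_le.
- move=> eta /[dup] hab /andP[ae _]; have e0 := lt_le_trans a0 ae.
  rewrite -[leLHS]subr0 lerB//; first by rewrite ler_pdivlMr// gq.
  rewrite pmulr_lle0 ?invr_gt0// subr_le0 expR_le1 /rate.
  have : 0 <= eta * T%:R by rewrite mulr_ge0 ?ler0n ?ltW.
  have : 0 <= eta ^+ 2 * T%:R by rewrite mulr_ge0 ?ler0n ?exprn_ge0 ?ltW.
  by rewrite mulrN; lra.
Qed.

(** Convexity of e^z - 1, which vanishes at 0. *)
Lemma expR_mul_sub1_ge (m L : R) : 0 <= L -> 1 <= m ->
  m * (expR L - 1) <= expR (m * L) - 1.
Proof.
move=> L0 m1.
have -> : m * L = L + (m - 1) * L by ring.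
rewrite expRD; have := expR_ge1Dx (- L); rewrite expRN => h1.
have h2 := expR_ge1Dx ((m - 1) * L).
have e0 := expR_gt0 L.
have h3 : expR L - 1 <= expR L * L.
  have : (1 - L) * expR L <= 1 by rewrite -ler_pdivlMr// div1r.
  by lra.
have : expR L * (1 + (m - 1) * L) <= expR L * expR ((m - 1) * L).
  by rewrite ler_pM2l.
have : 0 <= (m - 1) * (expR L * L - (expR L - 1)) by apply: mulr_ge0; lra.
by lra.
Qed.

(** The gain is taken on [1/4, 1/2], where the rate is at least eta (x - V / 2) >= 4 eta L. By
    convexity e^(4 eta L) - 1 >= 4 eta (e^L - 1) = 8 eta X, and 8 X integrates to 2 X. *)
Lemma potential_ge_small_variance (T : nat) x V U X s : (0 < T)%N ->
    0 <= V <= T%:R -> 7 / 6 <= X -> 0 <= s -> s ^+ 2 = 2 * ln X ->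
    U = Num.sqrt (2 * V) * (1 + s) + 5 * ln (1 + 2 * X) -> V < U -> U <= x ->
  2 * X - (2^-1 + ln T.+1%:R) <= squint_potential x V.
Proof.
move=> T0 /andP[V0 VT] X1 s0 s2 UE VU Ux.
set q := Num.sqrt (2 * V) in UE; set L := ln (1 + 2 * X) in UE.
have q2 : q ^+ 2 = 2 * V by rewrite sqr_sqrtr//; lra.
have q0 : 0 <= q by exact: sqrtr_ge0.
have eL : expR L = 1 + 2 * X by rewrite lnK// posrE; lra.
have L0 : 0 < L by rewrite ln_gt0//; lra.
(* Reduces to 1 + 2 X <= e X^2, where e >= 8/3. *)
have sL : L <= (1 + s) ^+ 2.
  suff : L <= 1 + 2 * ln X by lra.
  have -> : 1 + 2 * ln X = 1 + (ln X + ln X) by ring.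
  rewrite -ler_expR eL !expRD lnK ?posrE; last lra.
  have : 1 + 1 + 1 ^+ 2 / 2 + 1 ^+ 3 / 6 <= expR 1 :> R by exact: expR_ge_cubic.
  rewrite !expr1n => e1; have : 8 / 3 * (X * X) <= expR 1 * (X * X).
    by rewrite ler_wpM2r// ?mulr_ge0//; lra.
  by nra.
(* If V >= 8 L, use U > V. Otherwise [sL] gives q <= 4 (1 + s), so V / 2 = q^2 / 4 <= q (1 + s) and
   5 L is left over. *)
have hU : 4 * L <= U - V / 2.
  have [hV|hV] := leP (8 * L) V; first lra.
  have qs : q <= 4 * (1 + s).
    rewrite -(@ler_pXn2r _ 2) ?nnegrE//; last lra.
    by rewrite exprMn; lra.
  have : q * q <= q * (4 * (1 + s)) by exact: ler_wpM2l.
  by rewrite -expr2 q2; lra.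
have -> : 2 * X = \int[mu]_(eta in `[4^-1, 2^-1]) (8 * X).
  by rewrite Rintegral_itv_cst; [field|lra].
apply: potential_ge_gain => //; [have : 0 <= T%:R :> R by []; lra|lra| |].
  exact: integrable_itv_cst.
move=> eta /andP[e1 e2].
apply: (@le_trans _ _ (expR (4 * eta * L) - 1)).
  apply: le_trans (expR_mul_sub1_ge (4 * eta) L _ _); [|lra..].
  by rewrite eL; lra.
rewrite lerD2r ler_expR /rate.
have -> : eta * x - eta ^+ 2 * V = eta * (x - eta * V) by ring.
have -> : 4 * eta * L = eta * (4 * L) by ring.
rewrite ler_pM2l; last lra.
have : eta * V <= 2^-1 * V by rewrite ler_wpM2r.
lra.
Qed.

(* The gain is integrated over [(rho - 1) / q, rho / q] with q = sqrt (2 V) and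
   rho = 1 + s: rho / q maximises [rate (q * rho) V], and on this interval the
   rate stays within 1/2 of its maximum rho^2 / 2. *)
Lemma potential_ge_large_variance (T : nat) x V U X s : (0 < T)%N ->
    0 <= V <= T%:R -> 2^-1 + ln T.+1%:R <= X -> 7 / 6 <= X ->
    0 <= s -> s ^+ 2 = 2 * ln X ->
    U = Num.sqrt (2 * V) * (1 + s) + 5 * ln (1 + 2 * X) -> U <= V -> U <= x ->
  2 * X - (2^-1 + ln T.+1%:R) <= squint_potential x V.
Proof.
move=> T0 /andP[V0 VT] XT X1 s0 s2 UE UV Ux.
have [X3 s3] : 36 / 10 <= X /\ 157 / 100 <= s.
  by apply: (large_variance_bootstrap T X V s) => //; rewrite -UE.
set q := Num.sqrt (2 * V) in UE; set L := ln (1 + 2 * X) in UE.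
have q2 : q ^+ 2 = 2 * V by rewrite sqr_sqrtr//; lra.
have L0 : 0 < L by rewrite ln_gt0//; lra.
have q0 : 0 < q.
  rewrite lt_neqAle sqrtr_ge0 andbT eq_sym; apply/eqP => q0.
  by move: q2 UE; rewrite q0 mul0r expr0n /=; lra.
have XE : X = expR (s ^+ 2 / 2).
  by rewrite s2 mulrAC divff ?mul1r ?lnK// ?posrE; lra.
(* On the window the rate is at least ((1 + s)^2 - 1) / 2 = s + s^2 / 2, so [K] bounds the numerator
   of the integrand from below. *)
pose K := expR s * X - 1.
(* The factor 2 s + 1 is what the window requires: K ln (1 + 1 / s) >= 2 K / (2 s + 1). The -1 in
   [K] is paid for by X >= 36/10. *)
have Ks : 2 * s * X + X <= K.
  rewrite /K; have := expR_ge_cubic _ s0 => h.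
  have : (1 + s + s ^+ 2 / 2 + s ^+ 3 / 6) * X <= expR s * X.
    by rewrite ler_wpM2r//; lra.
  have : 1 / 36 * 10 <= s ^+ 2 / 2 + s ^+ 3 / 6 - s by nra.
  by nra.
have sq : 0 < s / q by rewrite divr_gt0//; lra.
have hlt : s / q <= (1 + s) / q by rewrite ler_pM2r ?invr_gt0//; lra.
(* The window fits below 1/2 because q (1 + s) <= U <= V = q^2 / 2. *)
have hle : (1 + s) / q <= 2^-1.
  by rewrite ler_pdivrMr//; nra.
apply: (@le_trans _ _ (\int[mu]_(eta in `[s / q, (1 + s) / q]) (K * eta^-1)
                      - (2^-1 + ln T.+1%:R))).
  rewrite lerD2r Rintegral_Zinv//.
  have -> : (1 + s) / q / (s / q) = 1 + s^-1 by field; rewrite !gt_eqF//; lra.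
  have si : 0 < s^-1 by rewrite invr_gt0; lra.
  apply: (@le_trans _ _ (K * (2 * s^-1 / (2 + s^-1)))); last first.
    by rewrite ler_wpM2l ?ln1D_ge//; nra.
  have -> : 2 * s^-1 / (2 + s^-1) = 2 / (2 * s + 1).
    by field; rewrite ?gt_eqF//; lra.
  by rewrite mulrA ler_pdivlMr; lra.
have U0 : 0 <= q * (1 + s) by rewrite mulr_ge0//; lra.
apply: potential_ge_gain => //; [have : 0 <= T%:R :> R by []; lra| |].
  exact: integrable_Zinv.
move=> eta /andP[e1 e2]; have e0 := lt_le_trans sq e1.
rewrite mulfVK ?gt_eqF// lerD2r {1}XE -expRD ler_expR.
rewrite ler_pdivrMr// in e1; rewrite ler_pdivlMr// in e2.
rewrite /rate; have -> : V = q ^+ 2 / 2 by lra.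
(* In terms of z = eta q, what remains is (1 + s - z)^2 <= 1, true for s <= z <= 1 + s. *)
have : eta * (q * (1 + s)) <= eta * x by rewrite ler_pM2l//; lra.
set z := eta * q in e1 e2 *.
have -> : eta * (q * (1 + s)) = z * (1 + s) by rewrite /z; ring.
have -> : eta ^+ 2 * (q ^+ 2 / 2) = z ^+ 2 / 2 by rewrite /z; field.
by nra.
Qed.

Lemma potential_ge_quantile (T : nat) x V X : (0 < T)%N ->
    0 <= V <= T%:R -> 2^-1 + ln T.+1%:R <= X ->
    Num.sqrt (2 * V) * (1 + Num.sqrt (2 * ln X)) + 5 * ln (1 + 2 * X) <= x ->
  2 * X - (2^-1 + ln T.+1%:R) <= squint_potential x V.
Proof.
move=> T0 VT XT Ux.
(* T >= 1 gives X >= 1/2 + ln 2 >= 1/2 + 2/3. *)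
have X1 : 7 / 6 <= X.
  have : 2 / 3 <= ln 2 :> R by exact: ln2_ge.
  have : ln 2 <= ln T.+1%:R :> R by rewrite ler_ln ?posrE ?ltr0n// ler_nat.
  by lra.
have s2 : Num.sqrt (2 * ln X) ^+ 2 = 2 * ln X.
  by rewrite sqr_sqrtr// mulr_ge0// ln_ge0//; lra.
have s0 := sqrtr_ge0 (2 * ln X).
set U := _ + _ in Ux.
have [VU|UV] := ltP V U.
- exact: (potential_ge_small_variance T x V U X _ T0 VT X1 s0 s2 erefl VU Ux).
- exact: (potential_ge_large_variance T x V U X _ T0 VT XT X1 s0 s2 erefl UV
            Ux).
Qed.

(** * Signs of the derivatives and the increment in one round *)

Lemma squint_dR_gt0 x V : 0 < squint_dR x V.
Proof.
rewrite squint_dRE.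
apply: (@lt_le_trans _ _ (\int[mu]_(eta in `[4^-1, 2^-1])
                            expR (- (`|x| + `|V|)))).
  by rewrite Rintegral_itv_cst; [rewrite mulr_gt0 ?expR_gt0//|]; lra.
apply: Rintegral_half_ge => //.
- by lra.
- exact: integrable_expR_rate.
- exact: integrable_itv_cst.
- move=> eta he; rewrite ler_expR.
  have h : 0 < eta <= 2^-1 by lra.
  by have := rate_norm_le x V eta h; rewrite ler_norml => /andP[].
Qed.

Lemma squint_dV_lt0 x V : 0 < - squint_dV x V.
Proof.
rewrite squint_dVE.
apply: (@lt_le_trans _ _ (\int[mu]_(eta in `[4^-1, 2^-1])
                            (4^-1 * expR (- (`|x| + `|V|))))).
  by rewrite Rintegral_itv_cst; [rewrite !mulr_gt0 ?expR_gt0//|]; lra.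
apply: Rintegral_half_ge => //.
- by lra.
- exact: integrable_mul_expR_rate.
- by move=> eta /andP[/ltW e0 _]; rewrite mulr_ge0 ?expR_ge0.
- exact: integrable_itv_cst.
- move=> eta he; have h : 0 < eta <= 2^-1 by lra.
  rewrite ler_pM ?expR_ge0 ?invr_ge0//; first by lra.
  rewrite ler_expR; have := rate_norm_le x V eta h.
  by rewrite ler_norml => /andP[].
Qed.

(** This is [expR_step_le] with a = eta r and b = eta^2 v, scaled by e^(rate x V eta) / eta. The
    quadratic term carries the weight at the updated point, which matches the implicit equation for
    v_t. *)
Lemma quot_step_le x V (r v eta : R) : -1 <= r -> 0 < eta <= 2^-1 ->
  quot (x + r) (V + v) eta - quot x V eta <=
  r * expR (rate x V eta) +
    (r ^+ 2 - v) * (eta * expR (rate (x + r) (V + v) eta)).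
Proof.
move=> r1 /andP[e0 e1].
have ha : - 2^-1 <= eta * r by nra.
rewrite /quot -mulrBl ler_pdivrMr//.
have -> : rate (x + r) (V + v) eta = rate x V eta + (eta * r - eta ^+ 2 * v).
  by rewrite /rate; ring.
rewrite expRD; have := expR_step_le _ (eta ^+ 2 * v) ha.
rewrite -(ler_pM2l (expR_gt0 (rate x V eta))).
set E := expR _; set F := expR _ => h.
rewrite -subr_ge0 in h; rewrite -subr_ge0; apply: le_trans h _.
by rewrite le_eqVlt; apply/orP; left; apply/eqP; ring.
Qed.

Lemma potential_step_le x V (r v : R) : -1 <= r ->
  squint_potential (x + r) (V + v) - squint_potential x V <=
  r * squint_dR x V + (r ^+ 2 - v) * - squint_dV (x + r) (V + v).
Proof.
move=> r1; rewrite squint_dRE squint_dVE !potentialE.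
have i1 := integrable_expR_rate x V.
have i2 := integrable_mul_expR_rate (x + r) (V + v).
have iq := integrableB _ (integrable_quot (x + r) (V + v))
  (integrable_quot x V).
rewrite -!RintegralZl// -RintegralB//; [|exact: integrable_quot..].
have j1 := integrableZl _ r i1.
have j2 := integrableZl _ (r ^+ 2 - v) i2.
rewrite -RintegralD//; [|exact: j1|exact: j2].
apply: le_Rintegral => //; [exact: iq| exact: (integrableD _ (j1 _) (j2 _)) |].
by move=> eta; rewrite /= in_itv/=; exact: quot_step_le.
Qed.

Lemma potential00 : squint_potential 0 0 = 0 :> R.
Proof.
rewrite potentialE (@eq_Rintegral _ _ _ _ _ (fun=> 0)).
  by rewrite Rintegral_itv_cst ?mul0r.
by move=> eta _; rewrite /quot /rate !mulr0 subrr expR0 subrr mul0r.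
Qed.

(** * Invariants of a run of the algorithm *)

Section Run.
Variables (N T : nat) (hN : (0 < N)%N) (l p : nat -> 'I_N -> R) (v : nat -> R).
Hypothesis hl : forall t, (1 <= t <= T)%N -> forall i, 0 <= l t i <= 1.
Hypothesis hrun : squint_run T p l v.

Lemma normalize_ge0 (w : 'I_N -> R) : (forall i, 0 < w i) ->
  forall i, 0 <= normalize w i.
Proof.
by move=> w0 i; apply: divr_ge0; [|apply: sumr_ge0 => j _]; exact: ltW.
Qed.

Lemma sum_weights_gt0 (w : 'I_N -> R) : (forall i, 0 < w i) -> 0 < \sum_i w i.
Proof.
move=> w0; rewrite (bigD1 (Ordinal hN))//=; apply: ltr_pwDl => //.
by apply: sumr_ge0 => j _; exact: ltW.
Qed.

Lemma sum_normalize (w : 'I_N -> R) : (forall i, 0 < w i) ->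
  \sum_i normalize w i = 1.
Proof.
by move=> w0; rewrite -mulr_suml divff// gt_eqF// sum_weights_gt0.
Qed.

(** Applied to the losses it cancels the linear term of the increment, and to the squared regrets
    the quadratic term. *)
Lemma weighted_mean (w f : 'I_N -> R) : (forall i, 0 < w i) ->
  \sum_i w i * (f i - \sum_j normalize w j * f j) = 0.
Proof.
move=> w0; have W0 := sum_weights_gt0 _ w0.
under eq_bigr do rewrite mulrBr.
rewrite sumrB -mulr_suml; apply/eqP; rewrite subr_eq0 mulr_sumr; apply/eqP.
by apply: eq_bigr => j _; rewrite /normalize; field; rewrite gt_eqF.
Qed.

Lemma weighted_mean_itv (w f : 'I_N -> R) (a b : R) : (forall i, 0 < w i) ->
  (forall i, a <= f i <= b) -> a <= \sum_j normalize w j * f j <= b.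
Proof.
move=> w0 fab; have n0 := normalize_ge0 _ w0.
apply/andP; split.
- rewrite -[leLHS]mul1r -(sum_normalize _ w0) mulr_suml ler_sum// => j _.
  by rewrite ler_wpM2l//; case/andP: (fab j).
- rewrite -[leRHS]mul1r -(sum_normalize _ w0) mulr_suml ler_sum// => j _.
  by rewrite ler_wpM2l//; case/andP: (fab j).
Qed.

Lemma squint_playE t : (1 <= t <= T)%N ->
  learner_loss (p t) (l t) =
  \sum_j normalize (fun j => squint_dR (cum_regret p l t.-1 j)
    (cum_variance v t.-1)) j * l t j.
Proof. by move=> ht; apply: eq_bigr => j _; rewrite (squint_play hrun ht). Qed.

Lemma inst_regret_norm t i : (1 <= t <= T)%N -> `|inst_regret p l t i| <= 1.
Proof.
move=> ht; have := hl _ ht i; rewrite /inst_regret squint_playE//.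
have := @weighted_mean_itv _ (l t) 0 1
  (fun j => squint_dR_gt0 (cum_regret p l t.-1 j) (cum_variance v t.-1))
  (hl _ ht).
by rewrite ler_norml; lra.
Qed.

Lemma variance_itv t : (1 <= t <= T)%N -> 0 <= v t <= 1.
Proof.
move=> ht; rewrite (squint_update hrun ht).
apply: weighted_mean_itv => i; first exact: squint_dV_lt0.
rewrite sqr_ge0/= -[_ ^+ 2]ger0_norm ?sqr_ge0// normrX exprn_ile1//.
exact: inst_regret_norm.
Qed.

Lemma cum_regretS t i :
  cum_regret p l t.+1 i = cum_regret p l t i + inst_regret p l t.+1 i.
Proof. by rewrite /cum_regret big_nat_recr. Qed.

Lemma cum_varianceS t : cum_variance v t.+1 = cum_variance v t + v t.+1.
Proof. by rewrite /cum_variance big_nat_recr. Qed.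

Lemma cum_variance_itv t : (t <= T)%N -> 0 <= cum_variance v t <= t%:R.
Proof.
elim: t => [_|t IH tT]; first by rewrite /cum_variance big_geq//= !lexx.
have /andP[h1 h2] := IH (ltnW tT); have /andP[h3 h4] := variance_itv t.+1 tT.
by rewrite cum_varianceS -natr1 addr_ge0//= lerD.
Qed.

Lemma cum_regret_ge t i : (t <= T)%N -> - t%:R <= cum_regret p l t i.
Proof.
elim: t => [_|t IH tT]; first by rewrite /cum_regret big_geq//= oppr0.
have h1 := IH (ltnW tT); have := inst_regret_norm t.+1 i tT.
by rewrite cum_regretS -natr1 opprD ler_norml => /andP[h2 _]; rewrite lerD.
Qed.

Lemma potential_sum_le0 t : (t <= T)%N ->
  \sum_i squint_potential (cum_regret p l t i) (cum_variance v t) <= 0.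
Proof.
elim: t => [_|t IH tT].
  rewrite big1// => i _; rewrite /cum_regret /cum_variance !big_geq//.
  exact: potential00.
apply: le_trans (IH (ltnW tT)); rewrite -subr_le0 -sumrB.
have tT' : (1 <= t.+1 <= T)%N by [].
apply: (@le_trans _ _ (\sum_i
    (inst_regret p l t.+1 i *
       squint_dR (cum_regret p l t i) (cum_variance v t)
     + (inst_regret p l t.+1 i ^+ 2 - v t.+1) *
       - squint_dV (cum_regret p l t.+1 i) (cum_variance v t.+1)))).
  apply: ler_sum => i _; rewrite cum_regretS cum_varianceS potential_step_le//.
  by have := inst_regret_norm t.+1 i tT'; rewrite ler_norml => /andP[].
rewrite big_split /=.
(* The play of round t + 1 uses these weights, so the learner's loss is the weighted mean of the
   losses. *)
have -> : \sum_i inst_regret p l t.+1 i *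
    squint_dR (cum_regret p l t i) (cum_variance v t) = 0.
  have := weighted_mean _ (l t.+1)
    (fun i => squint_dR_gt0 (cum_regret p l t i) (cum_variance v t)).
  move=> /(congr1 -%R); rewrite oppr0 -sumrN => h; rewrite -[RHS]h.
  apply: eq_bigr => i _.
  by rewrite /inst_regret squint_playE//= mulrC -mulrN opprB.
(* With the weights after the update, v_(t+1) is the weighted mean of the squared regrets. *)
rewrite add0r -[leRHS](weighted_mean _ (fun i => inst_regret p l t.+1 i ^+ 2)
  (fun i => squint_dV_lt0 (cum_regret p l t.+1 i) (cum_variance v t.+1))).
rewrite ler_sum// => i _.
by rewrite mulrC -(squint_update hrun tT').
Qed.

End Run.

End Squint.

(** * From the potential to the quantile regret *)

Theorem theorem4 (R : realType) (N T : nat) (hN : (2 <= N)%N) (hT : (1 <= T)%N)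
    (l p : nat -> 'I_N -> R) (v : nat -> R)
    (hl : forall t, (1 <= t <= T)%N -> forall i, 0 <= l t i <= 1)
    (hrun : squint_run T p l v) :
  forall eps : R, N%:R^-1 <= eps -> eps < 1 ->
  forall i : 'I_N, quantile_expert (cum_loss l T) eps i ->
    regret_against p l T i <=
      Num.sqrt (2 * cum_variance v T) *
        (1 + Num.sqrt (2 * ln ((2^-1 + ln (T.+1)%:R) / eps)))
      + 5 * ln (1 + (1 + 2 * ln (T.+1)%:R) / eps).
Proof.
move=> eps epsN eps1 i [s [sorted_s [j [jE iE]]]].
have N0 : (0 < N)%N by apply: leq_trans hN.
have NR0 : 0 < N%:R :> R by rewrite ltr0n.
have eps0 : 0 < eps by rewrite (lt_le_trans _ epsN)// invr_gt0.
set B := 2^-1 + ln T.+1%:R; pose X := B / eps.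
have -> : (1 + 2 * ln T.+1%:R) / eps = 2 * X.
  by rewrite /X /B; field; rewrite gt_eqF.
set V := cum_variance v T; set U := _ + _.
have B0 : 0 < B by rewrite ltr_pwDl ?invr_gt0// ln_ge0// ler1n.
have XE : X * eps = B by rewrite mulfVK// gt_eqF.
have regE k : cum_regret p l T k =
    \sum_(1 <= t < T.+1) learner_loss (p t) (l t) - cum_loss l T k.
  by rewrite /cum_regret /cum_loss sumrB.
rewrite leNgt; apply/negP => /ltW; rewrite /regret_against -regE => Ui.
have hV := @cum_variance_itv R N T N0 l p v hl hrun T (leqnn T).
have BX : B <= X by rewrite ler_pdivlMr// ler_piMr// ltW.
have hlow k : - B <= squint_potential (cum_regret p l T k) V.
  apply: le_trans (@potential_ge R T hT) _; apply: potential_le.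
    exact: (@cum_regret_ge R N T N0 l p v hl hrun T k (leqnn T)).
  by case/andP: hV.
(* Experts at positions up to j lose no more than i = s j, so their regret is at least as large.
   Positions count from 0, so there are j + 1 = floor (eps N) of them. *)
have htop (k : 'I_N) : (k <= j)%N ->
    2 * X - B <= squint_potential (cum_regret p l T (s k)) V.
  move=> kj; apply: (@potential_ge_quantile R T) => //.
  by apply: le_trans Ui _; rewrite !regE iE lerD2l lerN2 sorted_s.
have := @potential_sum_le0 R N T N0 l p v hl hrun T (leqnn T).
rewrite (reindex_inj (@perm_inj _ s)) /= leNgt => /negP; apply.
apply: (@lt_le_trans _ _
    (\sum_(k < N) ((if (k < j.+1)%N then 2 * X else 0) - B))); last first.
  apply: ler_sum => k _; rewrite ltnS; case: ifP => [/htop//|_].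
  by rewrite sub0r.
rewrite sumrB -big_mkcond /= -(big_ord_widen N (fun=> 2 * X))//.
rewrite !sumr_const !card_ord -[_ *+ j.+1]mulr_natr -[B *+ N]mulr_natr.
have hf : N%:R * eps < j.+1%:R + 1.
  have := floor_itv (eps * N%:R); rewrite -jE => /andP[_].
  by rewrite mulrC intrD.
have j1 : 1 <= j.+1%:R :> R by rewrite ler1n.
(* With k = j + 1 the claim is B N < 2 X k, and B N = X eps N < X (k + 1) <= 2 X k since k >= 1. *)
rewrite subr_gt0 -XE; apply: (@lt_le_trans _ _ (X * (j.+1%:R + 1))).
  by rewrite -mulrA ltr_pM2l 1?mulrC//; lra.
have : 0 <= X * (j.+1%:R - 1) by rewrite mulr_ge0//; lra.
by lra.
Qed.
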